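(* Let $a\geqslant 3$ be an integer and let $\beta>1$ satisfy $\beta^2=a\beta-1$. Every alphabet of contiguous integers containing $0$ with exactly $a$ elements allows parallel addition in base $\beta$, and no alphabet of contiguous integers containing $0$ and at least one other element, with fewer than $a$ elements, allows parallel addition in base $\beta$.
   Context: For a complex number $\beta$ with $|\beta|>1$ and a finite set $\mathcal{A}\subset\mathbb{C}$ containing $0$, let $\mathrm{Fin}_{\mathcal{A}}(\beta)=\{\sum_{j\in I}x_j\beta^j : I\subset\mathbb{Z}\text{ finite},\ x_j\in\mathcal{A}\}$. For finite alphabets $\mathcal{A},\mathcal{B}$, a map $\varphi:\mathcal{A}^{\mathbb{Z}}\to\mathcal{B}^{\mathbb{Z}}$ is $p$-local if there are integers $r,t\geqslant 0$ with $p=r+t+1$ and a map $\Phi:\mathcal{A}^p\to\mathcal{B}$ such that for every $u=(u_j)$ and $v=\varphi(u)$ one has $v_j=\Phi(u_{j+t}\cdots u_j\cdots u_{j-r})$ for all $j\in\mathbb{Z}$. A digit set conversion in base $\beta$ from $\mathcal{A}$ to $\mathcal{B}$ (both containing $0$) is a map $\varphi:\mathcal{A}^{\mathbb{Z}}\to\mathcal{B}^{\mathbb{Z}}$ such that whenever $u$ has finitely many nonzero entries, $v=\varphi(u)$ has finitely many nonzero entries and $\sum_j v_j\beta^j=\sum_j u_j\beta^j$. An alphabet $\mathcal{A}$ allows parallel addition in base $\beta$ if there is a digit set conversion in base $\beta$ from $\mathcal{A}+\mathcal{A}=\{x+y:x,y\in\mathcal{A}\}$ to $\mathcal{A}$ that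 is $p$-local for some $p$. *)

(* Defs.v *)
From HB Require Import structures.
From mathcomp Require Import all_boot all_order all_algebra finmap.
From mathcomp Require Import classical_sets cardinality fsbigop reals.
From mathcomp Require Import complex.

Set Implicit Arguments.
Unset Strict Implicit.
Unset Printing Implicit Defensive.

Import Order.TTheory GRing.Theory Num.Theory.

Local Open Scope ring_scope.

(* A finite alphabet is a finite set [A : {fset R[i]}]; its coercion to a type
   makes [int -> A] the space of bi-infinite words over [A]. *)

Section ParallelAddition.
Variable R : realType.
Implicit Types (A B : {fset R[i]}) (beta : R[i]).

Definition finitely_supported A (u : int -> A) : Prop :=
  finite_set [set j : int | val (u j) != 0]%classic.

(* The big operator sums over the set of indices where the summand is nonzero,
   and is 0 when that set is infinite; it is only used below for finitely
   supported words. *)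
Definition word_value beta A (u : int -> A) : R[i] :=
  \sum_(j \in [set: int]%classic) val (u j) * beta ^ j.

(* The window is read from the left, u_(j+t) ... u_j ... u_(j-r). *)
Definition p_local (p : nat) A B (phi : (int -> A) -> (int -> B)) : Prop :=
  exists r t : nat, p = (r + t + 1)%N /\
    exists Phi : p.-tuple A -> B, forall (u : int -> A) (j : int),
      phi u j = Phi [tuple u (j + t%:Z - (i : nat)%:Z) | i < p].

Definition digit_set_conversion beta A B
    (phi : (int -> A) -> (int -> B)) : Prop :=
  [/\ 0 \in A, 0 \in B &
      forall u : int -> A, finitely_supported u ->
        finitely_supported (phi u) /\
        word_value beta (phi u) = word_value beta u].

Definition sumset A B : {fset R[i]} := [fset (x + y)%R | x in A, y in B]%fset.

Definition allows_parallel_addition beta A : Prop :=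
  exists phi : (int -> sumset A A) -> (int -> A),
    digit_set_conversion beta phi /\ exists p : nat, p_local p phi.

Definition contiguous_integers A : Prop :=
  exists m M : int, m <= M /\
    forall x : R[i], x \in A <-> exists2 k : int, m <= k <= M & x = k%:~R.

End ParallelAddition.

(* Main.v *)
Require Import Defs.
From HB Require Import structures.
From mathcomp Require Import all_boot all_order all_algebra finmap.
From mathcomp Require Import classical_sets cardinality fsbigop reals.
From mathcomp Require Import complex.
From mathcomp Require Import boolp zify ring lra.

Set Implicit Arguments.
Unset Strict Implicit.
Unset Printing Implicit Defensive.

Import Order.TTheory GRing.Theory Num.Theory.

Local Open Scope ring_scope.

(** Adding multiples of the relation (1, -a, 1) at each position does not change
the value of a word, so a carry word q with entries in {0, 1} turns u into
u_j - a q_j + q_(j-1) + q_(j+1).  Over the digits m..M with M = m + a - 1, a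
carry word with q_j = 1 iff u_j + q_(j-1) + q_(j+1) > M lowers by one the maximum
of the digits exceeding M without creating digits below min(m, u_j).  Such a q
can be computed locally, so finitely many rounds, followed by finitely many
rounds of the mirror image, bring 2m..2M back into m..M.

For minimality, suppose that 0 < M (otherwise take opposites) and that there are
fewer than a digits.  Let c be the image of the constant word with letter M.
Comparing the values of the images of two blocks M...M of consecutive lengths and
reducing beta to 1 gives c = M modulo a - 2, so c = M, or c = m and
M - m = a - 2.  The latter makes the image of a block of M's too small.  In the
former case a block M...M followed by the digit 2M has too large a value, because
2(beta - 1) > beta. *)

(** * Words over the integers and their values *)

Definition fin_supp (u : int -> int) : Prop :=
  exists N : nat, forall j : int, (N < `|j|)%N -> u j = 0.

Lemma fin_suppP (u : int -> int) :
  fin_supp u <-> finite_set [set j | u j != 0]%classic.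
Proof.
split=> [[N uN]|/finite_seqP[s sE]].
  pose s : seq int := [seq i%:Z - N%:Z | i <- iota 0 (N + N).+1].
  apply: (@sub_finite_set _ _ [set` s]%classic); last by apply/finite_seqP; exists s.
  move=> j uj; have jN : ~ (N < `|j|)%N by move=> /uN/eqP; rewrite (negbTE uj).
  by apply/mapP; exists `|(j + N%:Z)%R|%N; rewrite ?mem_iota; lia.
exists (\max_(j <- s) `|j|)%N => j jN; apply/eqP; apply: contraLR jN => uj.
rewrite -leqNgt; apply: (@leq_bigmax_seq _ _ predT) => //.
by have : [set` s]%classic j by rewrite -sE.
Qed.

Definition eval_word (F : fieldType) (x : F) (u : int -> int) : F :=
  \sum_(j \in [set: int]%classic) (u j)%:~R * x ^ j.

Section EvalWord.
Variables (F : fieldType) (x : F).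

Lemma eval_wordE (N n : nat) u :
  (forall j : int, (j < - N%:Z) || (n%:Z - N%:Z <= j) -> u j = 0) ->
  eval_word x u = \sum_(i < n) (u (i%:Z - N%:Z))%:~R * x ^ (i%:Z - N%:Z).
Proof.
move=> uN; rewrite /eval_word (@fsbigE _ _ _ _ _ [seq i%:Z - N%:Z | i <- iota 0 n]) //.
- rewrite big_map (eq_bigl xpredT); last by move=> i; rewrite in_setT.
  by rewrite -[n in iota 0 n]subn0 big_mkord.
- by rewrite map_inj_uniq ?iota_uniq// => i j; lia.
- move=> j _ jN; rewrite uN ?mul0r//; apply: contraR jN => jN.
  by apply/mapP; exists `|(j + N%:Z)%R|%N; rewrite ?mem_iota; lia.
Qed.

Lemma fin_supp_bound u : fin_supp u ->
  exists N0 : nat, forall N : nat, (N0 <= N)%N ->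
    forall j : int, (j < - N%:Z) || ((N + N).+1%:Z - N%:Z <= j) -> u j = 0.
Proof. by move=> [N0 uN]; exists N0 => N NN j jN; apply: uN; lia. Qed.

Lemma fin_suppD u v : fin_supp u -> fin_supp v -> fin_supp (u \+ v).
Proof.
by move=> [N uN] [P vP]; exists (maxn N P) => j jN; rewrite /= uN ?vP ?addr0//; lia.
Qed.

Lemma fin_suppZ k u : fin_supp u -> fin_supp (fun j => k * u j).
Proof. by move=> [N uN]; exists N => j /uN ->; rewrite mulr0. Qed.

Lemma fin_supp_shift k u : fin_supp u -> fin_supp (fun j => u (j + k)).
Proof. by move=> [N uN]; exists (N + `|k|)%N => j jN; apply: uN; lia. Qed.

Lemma eval_wordD u v : fin_supp u -> fin_supp v ->
  eval_word x (u \+ v) = eval_word x u + eval_word x v.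
Proof.
move=> /fin_supp_bound[N uN] /fin_supp_bound[P vP]; pose Q := maxn N P.
rewrite !(@eval_wordE Q (Q + Q).+1).
- by rewrite -big_split/=; apply: eq_bigr => i _; rewrite intrD mulrDl.
- by apply: vP; rewrite leq_maxr.
- by apply: uN; rewrite leq_maxl.
- by move=> j jN; rewrite /= (uN Q) ?(vP Q) ?leq_maxl ?leq_maxr.
Qed.

Lemma eval_wordZ k u : fin_supp u ->
  eval_word x (fun j => k * u j) = k%:~R * eval_word x u.
Proof.
move=> /fin_supp_bound[N uN]; rewrite !(@eval_wordE N (N + N).+1); last 2 first.
- exact: uN.
- by move=> j jN; rewrite (uN N) ?mulr0.
by rewrite mulr_sumr; apply: eq_bigr => i _; rewrite intrM mulrA.
Qed.

Hypothesis x0 : x != 0.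

Lemma eval_word_shift (k : int) u : fin_supp u ->
  eval_word x (fun j => u (j - k)) = x ^ k * eval_word x u.
Proof.
move=> /fin_suppP uN; rewrite /eval_word (@reindex_fsbigT _ _ _ _ _ (fun j => j + k)); last first.
  by exists (fun j => j - k) => j; rewrite ?addrK ?subrK.
rewrite mulr_fsumr; apply: eq_fsbigr => j _.
by rewrite addrK expfzDr// [_ * x ^ k]mulrC mulrCA.
Qed.

Lemma eval_word_poly (N n : nat) u :
  (forall j : int, (j < - N%:Z) || (n%:Z - N%:Z <= j) -> u j = 0) ->
  x ^+ N * eval_word x u =
    (map_poly intr (\poly_(i < n) u (i%:Z - N%:Z))).[x].
Proof.
move=> /eval_wordE ->; rewrite mulr_sumr poly_def rmorph_sum horner_sum/=.
apply: eq_bigr => i _; rewrite map_polyZ/= map_polyXn hornerZ hornerXn.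
by rewrite mulrCA exprnP -expfzDr// (addrC N%:Z) subrK.
Qed.

End EvalWord.

(** Comparing two words at two different positions builds shift invariance into locality, so no
    window function has to be carried around. *)
Definition word_local (k : nat) (f : (int -> int) -> int -> int) : Prop :=
  forall u u' j j', (forall i : int, (`|i| <= k)%N -> u (j + i) = u' (j' + i)) ->
    f u j = f u' j'.

Lemma word_local_comp k l f g :
  word_local k f -> word_local l g -> word_local (k + l) (f \o g).
Proof.
move=> fk gl u u' j j' uu'; apply: fk => i ik; apply: gl => i' il.
by rewrite -!addrA; apply: uu'; lia.
Qed.

Lemma word_local_id : word_local 0 id.
Proof. by move=> u u' j j' /(_ 0 isT); rewrite !addr0. Qed.

Lemma word_local_iter k f n : word_local k f -> word_local (n * k) (iter n f).
Proof.
move=> fk; elim: n => [|n IHn]; first exact: word_local_id.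
exact: word_local_comp.
Qed.

Definition word_opp (f : (int -> int) -> int -> int) (u : int -> int) (j : int) :=
  - f (fun i => - u i) j.

Lemma word_local_opp k f : word_local k f -> word_local k (word_opp f).
Proof. by move=> fk u u' j j' uu'; congr -%R; apply: fk => i /uu' ->. Qed.

Lemma word_local_fin_supp k f u :
  word_local k f -> f (fun=> 0) 0 = 0 -> fin_supp u -> fin_supp (f u).
Proof.
move=> fk f0 [N uN]; exists (N + k)%N => j jN; rewrite -f0; apply: fk => i ik.
by apply: uN; lia.
Qed.

Section ValuePreserving.
Variables (F : fieldType) (x : F).

Definition value_preserving (f : (int -> int) -> int -> int) : Prop :=
  forall u, fin_supp u -> fin_supp (f u) /\ eval_word x (f u) = eval_word x u.

Lemma value_preserving_comp f g :
  value_preserving f -> value_preserving g -> value_preserving (f \o g).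
Proof. by move=> fx gx u /gx[/fx[? fE] <-]. Qed.

Lemma value_preserving_iter f n :
  value_preserving f -> value_preserving (iter n f).
Proof. by move=> fx; elim: n => [|n IHn] //; exact: value_preserving_comp. Qed.

Lemma fin_suppN u : fin_supp u -> fin_supp (fun j => - u j).
Proof. by move=> [N uN]; exists N => j /uN ->; rewrite oppr0. Qed.

Lemma eval_wordN u : fin_supp u ->
  eval_word x (fun j => - u j) = - eval_word x u.
Proof.
move=> /(eval_wordZ x (-1)); rewrite mulN1r => <-.
by apply: eq_fsbigr => j _; rewrite mulN1r.
Qed.

Lemma value_preserving_opp f :
  value_preserving f -> value_preserving (word_opp f).
Proof.
move=> fx u us; have [fs fE] := fx _ (fin_suppN us).
by split; [exact: fin_suppN|rewrite eval_wordN// fE eval_wordN// opprK].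
Qed.

End ValuePreserving.

(** * Local carries *)

(* The fixed-point equation [carry_stable] has to be solved locally.  Runs of
   length at least 2 of digits >= M support their own carries, an isolated M never
   receives one, and the carry at an M - 1 between two carries propagates no further.
   The seed is wrong for M = 0, where it puts a carry everywhere on the zero word. *)
Definition seed (M : int) (u : int -> int) (j : int) : bool :=
  (M < u j) || (u j == M) && ((M <= u (j - 1)) || (M <= u (j + 1))).

Definition carry (M : int) (u : int -> int) (j : int) : bool :=
  seed M u j || [&& u j == M - 1, seed M u (j - 1) & seed M u (j + 1)].

Definition lower_step (a : nat) (M : int) (u : int -> int) (j : int) : int :=
  u j - a%:Z * carry M u j + (carry M u (j - 1) + carry M u (j + 1))%:Z.

Lemma carry_stable M u j :
  carry M u j = (M < u j + (carry M u (j - 1) + carry M u (j + 1))%:Z).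
Proof.
rewrite /carry /seed.
have -> : j - 1 + 1 = j by lia.
have -> : j + 1 - 1 = j by lia.
move: (u (j - 1 - 1)) (u (j + 1 + 1)) (u (j - 1)) (u j) (u (j + 1)) => x y z t w.
case: (ltrgtP t M) => ht; case: (ltrgtP z M) => hz; case: (ltrgtP w M) => hw;
  case: (lerP M x) => hx; case: (lerP M y) => hy; case: (eqVneq t (M - 1)) => h;
  rewrite ?orbT ?orbF ?andbT ?andbF /=; lia.
Qed.

(** By [carry_stable], a position without carry ends between [u j] and [M]. A position with carry
    has at least [M + 1] before [a] is removed, hence ends at least at [m]; it gains at most 2 and
    loses [a >= 3], so it drops by at least one. *)
Lemma lower_step_bounds (a : nat) (m M B : int) u j :
  (3 <= a)%N -> M - m = a%:Z - 1 -> u j <= B ->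
  Num.min m (u j) <= lower_step a M u j <= Num.max M (B - 1).
Proof.
move=> a3 aE uB; have := carry_stable M u j; rewrite /lower_step.
by case: (carry M u j); case: (carry M u (j - 1)); case: (carry M u (j + 1)); lia.
Qed.

Lemma word_local_seed M u u' j j' :
  (forall i : int, (`|i| <= 1)%N -> u (j + i) = u' (j' + i)) ->
  seed M u j = seed M u' j'.
Proof.
move=> uu'; have := uu' 0 isT; rewrite !addr0 => uu'0.
by rewrite /seed uu'0 (uu' 1 isT) (uu' (-1) isT).
Qed.

Lemma word_local_carry M : word_local 2 (fun u j => (carry M u j)%:Z).
Proof.
move=> u u' j j' uu'; rewrite /carry.
have H k : (`|k| <= 1)%N -> seed M u (j + k) = seed M u' (j' + k).
  by move=> k1; apply: word_local_seed => i i1; rewrite -!addrA; apply: uu'; lia.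
have := H 0 isT; have := uu' 0 isT; rewrite !addr0 => -> ->.
by rewrite (H 1 isT) (H (-1) isT).
Qed.

Lemma word_local_lower_step a M : word_local 3 (lower_step a M).
Proof.
move=> u u' j j' uu'; rewrite /lower_step !PoszD.
have H k : (`|k| <= 1)%N -> (carry M u (j + k))%:Z = carry M u' (j' + k).
  move=> k1; apply: (@word_local_carry M) => i i1.
  by rewrite -!addrA; apply: uu'; lia.
have := H 0 isT; have := uu' 0 isT; rewrite !addr0 => -> ->.
by rewrite (H 1 isT) (H (-1) isT).
Qed.

Lemma value_preserving_lower_step (F : fieldType) (x : F) a M :
  x != 0 -> x ^+ 2 = a%:R * x - 1 -> 0 < M ->
  value_preserving x (lower_step a M).
Proof.
move=> x0 xE M0 u us; pose c j : int := carry M u j.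
have cs : fin_supp c.
  by apply: (word_local_fin_supp (@word_local_carry M)) => //; rewrite /carry /seed; lia.
have csD k := fin_supp_shift k cs.
have -> : lower_step a M u =
  u \+ ((fun j => - a%:Z * c j) \+ ((fun j => c (j - 1)) \+ (fun j => c (j - -1)))).
  apply: funext => j; rewrite /lower_step /c /=.
  have -> : j - -1 = j + 1 by lia.
  by rewrite PoszD mulNr -addrA.
have cs2 : fin_supp ((fun j => c (j - 1)) \+ (fun j => c (j - -1))).
  by apply: fin_suppD; exact: csD.
split; first by do 2?apply: fin_suppD => //; exact: fin_suppZ.
rewrite eval_wordD//; last by apply: fin_suppD => //; exact: fin_suppZ.
rewrite eval_wordD//; last exact: fin_suppZ.
rewrite eval_wordD; try exact: csD.
rewrite eval_wordZ// !eval_word_shift// exprN1 expr1z intrN mulNr.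
(* Dividing the equation of the base by [x] shows that the carry word and its two shifts cancel in
   value. *)
have -> : a%:Z%:~R = x + x^-1 by rewrite -pmulrn; apply: (mulIf x0); rewrite mulrDl mulVf// -expr2 xE subrK.
by rewrite -mulrDl addNr addr0.
Qed.

(** * Digit set conversion over the integers *)

Definition int_conversion (F : fieldType) (x : F) (m M : int)
    (f : (int -> int) -> int -> int) : Prop :=
  forall u, (forall j, 2 * m <= u j <= 2 * M) ->
    (forall j, m <= f u j <= M) /\
    (fin_supp u -> fin_supp (f u) /\ eval_word x (f u) = eval_word x u).

Lemma lower_iter_bounds (a : nat) (m M B : int) (n : nat) u :
  (3 <= a)%N -> M - m = a%:Z - 1 -> (forall j, B <= u j <= M + n%:Z) -> B <= m ->
  forall j, B <= iter n (lower_step a M) u j <= M.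
Proof.
move=> a3 aE uB Bm.
have H k j : B <= iter k (lower_step a M) u j <= Num.max M (M + n%:Z - k%:Z).
  elim: k j => [|k IHk] j /=; first by have := uB j; lia.
  have := lower_step_bounds a3 aE (proj2 (andP (IHk j))); have := IHk j; lia.
by move=> j; have := H n j; lia.
Qed.

Lemma exists_int_conversion (F : fieldType) (x : F) (a : nat) (m M : int) :
  x != 0 -> x ^+ 2 = a%:R * x - 1 -> (3 <= a)%N -> M - m = a%:Z - 1 ->
  m <= 0 <= M -> exists k f, word_local k f /\ int_conversion x m M f.
Proof.
move=> x0 xE a3 aE mM.
(* Digits in [2 * m .. 2 * M] exceed [M] by at most [M] and fall short of [m] by at most [- m],
   which fixes the numbers of rounds; each round has radius 3. *)
exists (`|m| * 3 + `|M| * 3)%N.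
exists (iter `|m| (word_opp (lower_step a (- m))) \o iter `|M| (lower_step a M)).
split.
  apply: word_local_comp; apply: word_local_iter; last exact: word_local_lower_step.
  exact/word_local_opp/word_local_lower_step.
move=> u uM; split; last first.
  move: u {uM}; rewrite -/(value_preserving x _).
  (* If [M = 0] or [m = 0], where the carry rule fails on the zero word, the corresponding number of
     rounds is zero. *)
  have iterP n N : 0 <= n -> (0 < n -> value_preserving x N) ->
    value_preserving x (iter `|n| N).
    rewrite le0r => /predU1P[->|n0] // /(_ n0); exact: value_preserving_iter.
  apply: value_preserving_comp; last first.
    by apply: iterP => [|M0]; [lia|exact: value_preserving_lower_step].
  rewrite -abszN; apply: iterP => [|m0]; first by lia.
  exact/value_preserving_opp/value_preserving_lower_step.
pose v := iter `|M| (lower_step a M) u.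
have vM : forall j, 2 * m <= v j <= M.
  apply: (lower_iter_bounds a3 aE); last by lia.
  by move=> j; have := uM j; lia.
have -> : (iter `|m| (word_opp (lower_step a (- m))) \o iter `|M| (lower_step a M)) u
  = fun j => - iter `|m| (lower_step a (- m)) (fun i => - v i) j.
  rewrite /= -/v; elim: `|m|%N => [|n IHn] /=.
    by apply: funext => j; rewrite opprK.
  rewrite IHn; apply: funext => j; rewrite /word_opp; congr (- _).
  by congr (lower_step _ _ _ _); apply: funext => i; rewrite opprK.
move=> j; suff: - M <= iter `|m| (lower_step a (- m)) (fun i => - v i) j <= - m by lia.
apply: (@lower_iter_bounds a (- M)); [by []|by lia| |by lia].
by move=> i; have := vM i; lia.
Qed.

(** * Alphabets of contiguous integers *)

Section Alphabets.
Variable R : realType.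
Implicit Types (A B : {fset R[i]}) (m M : int).

Definition to_int (z : R[i]) : int := xget 0 [set k : int | z = k%:~R]%classic.

Lemma to_intK (k : int) : to_int k%:~R = k.
Proof.
rewrite /to_int; case: xgetP => [l _ /= /intr_inj <- //|/(_ k)/=].
by case.
Qed.

Definition alphabet A m M :=
  forall x : R[i], x \in A <-> exists2 k : int, m <= k <= M & x = k%:~R.

Lemma intr_alphabet A m M (k : int) : alphabet A m M ->
  (k%:~R \in A) = (m <= k <= M).
Proof.
move=> AE; apply/idP/idP => [/AE[l lm /intr_inj ->]//|km].
by apply/AE; exists k.
Qed.

Lemma alphabet_to_int A m M x : alphabet A m M -> x \in A ->
  (to_int x)%:~R = x /\ m <= to_int x <= M.
Proof. by move=> AE /AE[k km ->]; rewrite to_intK. Qed.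

Lemma alphabet_sumset A m M : alphabet A m M -> m <= M ->
  alphabet (sumset A A) (2 * m) (2 * M).
Proof.
move=> AE mM x; split.
  move=> /imfset2P[y /= /AE[k km ->]] [z /= /AE[l lm ->] ->].
  by exists (k + l); [lia|rewrite intrD].
(* [l] is the least first summand that keeps the second one at most [M]. *)
move=> [k km ->]; pose l := Num.max m (k - M).
apply/imfset2P; exists l%:~R; first by rewrite /= (intr_alphabet _ AE) /l; lia.
exists (k - l)%:~R; first by rewrite /= (intr_alphabet _ AE) /l; lia.
by rewrite -intrD; congr _%:~R; lia.
Qed.

Lemma card_alphabet A m M : alphabet A m M -> m <= M -> #|` A|%:Z = M - m + 1.
Proof.
move=> AE mM; pose n := `|(M - m + 1)%R|%N.
pose f (i : 'I_n) : R[i] := (m + i%:Z)%:~R.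
have inj : injective f.
  by move=> i j /intr_inj ij; apply/val_inj => /=; lia.
have -> : A = [fset f i | i in 'I_n]%fset.
  apply/fsetP => x; apply/idP/imfsetP => [/AE[k km ->]|[i _ ->]] /=; last first.
    by rewrite (intr_alphabet _ AE); have := ltn_ord i; lia.
  have kn : (`|(k - m)%R| < n)%N by lia.
  by exists (Ordinal kn); rewrite //= /f; congr _%:~R => /=; lia.
by rewrite card_imfset//= -cardE card_ord; lia.
Qed.

Definition digits A (u : int -> A) (j : int) : int := to_int (val (u j)).

Lemma digitsE A m M (u : int -> A) j : alphabet A m M ->
  (digits u j)%:~R = val (u j).
Proof. by move=> AE; case: (alphabet_to_int AE (valP (u j))). Qed.

Lemma digits_bounds A m M (u : int -> A) j : alphabet A m M -> m <= digits u j <= M.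
Proof. by move=> AE; case: (alphabet_to_int AE (valP (u j))). Qed.

Lemma finitely_supported_digits A m M (u : int -> A) : alphabet A m M ->
  finitely_supported u <-> fin_supp (digits u).
Proof.
move=> AE; rewrite fin_suppP /finitely_supported.
suff -> : [set j | val (u j) != 0]%classic = [set j | digits u j != 0]%classic by [].
by apply/funext => j /=; rewrite -(digitsE u j AE) intr_eq0.
Qed.

Lemma word_value_digits A m M (u : int -> A) (x : R) : alphabet A m M ->
  finitely_supported u -> word_value x%:C%C u = (eval_word x (digits u))%:C%C.
Proof.
move=> AE /(finitely_supported_digits u AE)/fin_supp_bound[N /(_ N (leqnn N)) uN].
have -> : word_value x%:C%C u = eval_word x%:C%C (digits u).
  by apply: eq_fsbigr => j _; rewrite (digitsE _ _ AE).
rewrite !(eval_wordE _ uN) [RHS]rmorph_sum/=; apply: eq_bigr => i _.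
by rewrite [RHS]rmorphM/= rmorph_int fmorphXz.
Qed.

Definition letters A (b : A) (u : int -> int) (j : int) : A := insubd b (u j)%:~R.

Lemma digits_letters A m M (b : A) u : alphabet A m M ->
  (forall j, m <= u j <= M) -> digits (letters b u) = u.
Proof.
move=> AE uM; apply: funext => j.
by rewrite /digits /letters insubdK ?to_intK// (intr_alphabet _ AE).
Qed.

(** This bridge reduces both halves of the theorem to shift-invariant local maps on integer
    words. *)
Lemma allows_parallel_additionP A m M (x : R) :
  alphabet A m M -> m <= 0 <= M ->
  allows_parallel_addition x%:C%C A <->
  exists k f, word_local k f /\ int_conversion x m M f.
Proof.
move=> AE m0M; have mM : m <= M by lia.
have A0 : 0 \in A by rewrite -[0]/(0%:~R) (intr_alphabet _ AE).
have BE := alphabet_sumset AE mM; set B := sumset A A in BE *.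
have B0 : 0 \in B by rewrite -[0]/(0%:~R) (intr_alphabet _ BE); lia.
pose zA : A := [` A0]%fset; pose zB : B := [` B0]%fset.
split=> [[phi [[_ _ phiP]] [p [r [t [pE [Phi PhiE]]]]]]|[k [f [fk fP]]]].
  exists (maxn r t), (fun u => digits (phi (letters zB u))); split.
    move=> u u' j j' uu'; rewrite /digits !PhiE; congr (to_int (val (Phi _))).
    apply: eq_mktuple => i; rewrite /letters -!addrA uu'//.
    by have := ltn_ord i; lia.
  move=> u uM; have uE := digits_letters zB BE uM.
  split=> [j|us]; first exact: (digits_bounds _ _ AE).
  have us' : finitely_supported (letters zB u) by rewrite (finitely_supported_digits _ BE) uE.
  have [vs] := phiP _ us'; rewrite (word_value_digits _ BE)// (word_value_digits _ AE)//.
  move=> /complexI; rewrite uE => ->; split=> //.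
  exact/(finitely_supported_digits _ AE).
exists (fun u => letters zA (f (digits u))); split; last first.
  exists (k + k + 1)%N, k, k; split=> //.
  (* Windows are read from the left, so offset [i] sits at index [k - i]. Offsets beyond [k] give
     meaningless entries, which [f] ignores by locality. *)
  exists (fun w => letters zA (f (fun i : int => to_int (val (nth zB w `|(k%:Z - i)%R|%N)))) 0).
  move=> u j; congr (insubd zA _%:~R); apply: fk => i ik; rewrite /digits.
  have ip : (`|(k%:Z - (0 + i))%R| < k + k + 1)%N by lia.
  rewrite (nth_mktuple _ _ (Ordinal ip))/=; congr (to_int (val (u _))); lia.
split=> // u us.
have [fB fs] := fP (digits u) (fun j => digits_bounds u j BE).
have vE := digits_letters zA AE fB.
have [|fus fE] := fs; first exact/(finitely_supported_digits _ BE).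
have vs : finitely_supported (letters zA (f (digits u))).
  by rewrite (finitely_supported_digits _ AE) vE.
by split=> //; rewrite (word_value_digits _ BE)// (word_value_digits _ AE)// vE fE.
Qed.

End Alphabets.

(** * Minimality *)

Section LowerBound.
Variables (R : realFieldType) (a : nat) (x : R).
Hypotheses (a3 : (3 <= a)%N) (x1 : 1 < x) (xE : x ^+ 2 = a%:R * x - 1).

Let x0 : x != 0. Proof. by rewrite gt_eqF// (lt_trans _ x1). Qed.

(** * Arithmetic of the base *)

Lemma root_gt2 : 2 < x.
Proof.
have : 3 <= a%:R :> R by rewrite (ler_nat R 3).
by move: x1 xE; nra.
Qed.

(** Descent on [|q|]: if [p = q x], then [r = p - (a - 1) q] equals [q (1 - 1/x)], because
    [x + 1/x = a]. Hence [r x = p - q] is again an integer, and [|r| < |q|] unless [q = 0]. *)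
Lemma root_irrational (p q : int) : p%:~R + q%:~R * x = 0 -> q = 0.
Proof.
suff H (n : nat) : forall q p : int, (`|q| <= n)%N -> p%:~R = q%:~R * x -> q = 0.
  move=> pq; apply: (H `|q|%N q (- p)) => //.
  by rewrite intrN; apply/esym/eqP; rewrite -addr_eq0 addrC pq.
elim: n => [|n IHn] {}q {}p qn pq; first by lia.
have [//|q_neq0] := eqVneq q 0.
pose r := p - (a%:Z - 1) * q.
have rE : r%:~R = q%:~R * (1 - x^-1).
  apply: (mulIf x0); rewrite -mulrA mulrBl mulVf// mul1r.
  rewrite /r !(intrD, intrN, intrM) -pmulrn pq.
  have -> : (q%:~R * x - (a%:R - 1) * q%:~R) * x = q%:~R * (x ^+ 2 - (a%:R - 1) * x) by ring.
  by rewrite xE; ring.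
have xgt0 : 0 < x := lt_trans ltr01 x1.
have xV : 0 < 1 - x^-1 < 1.
  by rewrite subr_gt0 invf_lt1// x1 gtrBl invr_gt0.
have rq : r%:~R * x = (p - q)%:~R.
  by rewrite rE -mulrA mulrBl mulVf// mul1r mulrBr mulr1 -pq -intrB.
have r0 : r = 0 -> q = 0.
  move=> r0; apply/eqP; rewrite -(intr_eq0 R).
  move: rE; rewrite r0 => /esym/eqP; rewrite mulf_eq0 => /orP[//|]; lra.
apply/r0/(IHn _ (p - q)); last by rewrite rq.
have [q0|q0|q0] := ltrgtP q 0; last by move: q_neq0; rewrite q0.
- have : q%:~R < 0 :> R by rewrite ltrz0.
  move=> q0R; have : q%:~R < r%:~R :> R by rewrite rE; nra.
  have : r%:~R < 0 :> R by rewrite rE; nra.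
  by rewrite ltrz0 ltr_int; lia.
- have : 0 < q%:~R :> R by rewrite ltr0z.
  move=> q0R; have : r%:~R < q%:~R :> R by rewrite rE; nra.
  have : 0 < r%:~R :> R by rewrite rE; nra.
  by rewrite ltr0z ltr_int; lia.
Qed.

(** [p + q X] is the remainder of [P] modulo [X^2 - a X + 1], a polynomial whose value at 1 is
    [2 - a]. *)
Lemma horner_linear (P : {poly int}) : exists p q z : int,
  (map_poly intr P).[x] = p%:~R + q%:~R * x /\ P.[1] = p + q + (a%:Z - 2) * z.
Proof.
elim/poly_ind: P => [|P c [p [q [z [PE P1]]]]].
  by exists 0, 0, 0; rewrite rmorph0 !horner0 mul0r addr0 mulr0.
exists (c - q), (p + a%:Z * q), (z - q); split; last first.
  by rewrite hornerMXaddC P1; ring.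
rewrite rmorphD rmorphM/= map_polyX map_polyC/= hornerMXaddC PE.
rewrite !(intrD, intrM, intrN) -pmulrn mulrDl -mulrA -expr2 xE; ring.
Qed.

Lemma root_dvd_horner1 (P : {poly int}) :
  (map_poly intr P).[x] = 0 -> exists z, P.[1] = (a%:Z - 2) * z.
Proof.
have [p [q [z [-> ->]]]] := horner_linear P => pq0.
have q0 := root_irrational pq0; move: pq0; rewrite q0 mul0r addr0.
by move=> /eqP; rewrite intr_eq0 => /eqP ->; exists z; rewrite !add0r.
Qed.

Definition delta (p j : int) : int := (j == p).

Lemma fin_supp_delta p : fin_supp (delta p).
Proof. by exists `|p|%N => j; rewrite /delta; lia. Qed.

Lemma eval_word_delta p : eval_word x (delta p) = x ^ p.
Proof.
have -> : delta p = fun j => delta 0 (j - p).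
  by apply: funext => j; rewrite /delta subr_eq0.
rewrite eval_word_shift//; last exact: fin_supp_delta.
rewrite (@eval_wordE _ _ 0 1); last by move=> j; rewrite /delta; lia.
by rewrite big_ord1 /= subr0 expr0z mulr1 mulr1.
Qed.

(** * Images of long blocks *)

Section Blocks.
Variables (k : nat) (f : (int -> int) -> int -> int) (m M : int).
Hypotheses (fk : word_local k f) (fP : int_conversion x m M f) (m0M : m <= 0 <= M).

(** The digit [y] just below the block is a free parameter: 0 for a plain block, [2 * M] to force an
    overflow. *)
Definition block (y b : int) (n : nat) (j : int) : int :=
  if j == -1 then y else if 0 <= j < n%:Z then b else 0.

Lemma fin_supp_block y b n : fin_supp (block y b n).
Proof. by exists n.+1 => j; rewrite /block; do 2?case: ifP; lia. Qed.

Lemma block_bounds y b n : 2 * m <= y <= 2 * M -> 2 * m <= b <= 2 * M ->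
  forall j, 2 * m <= block y b n j <= 2 * M.
Proof. by move=> yM bM j; rewrite /block; do 2?case: ifP; lia. Qed.

Lemma blockS y b n : block y b n.+1 = block y b n \+ (fun j => b * delta n j).
Proof.
apply: funext => j; rewrite /block /delta /=.
case: (eqVneq j n%:Z) => [->|jn]; first by rewrite mulr1; do 3?case: ifP; lia.
by rewrite mulr0 addr0; do 3?case: ifP; lia.
Qed.

Lemma eval_blockS y b n :
  eval_word x (block y b n.+1) = eval_word x (block y b n) + b%:~R * x ^+ n.
Proof.
have ds := fin_supp_delta n; rewrite blockS eval_wordD; last exact: fin_suppZ.
  by rewrite eval_wordZ// eval_word_delta.
exact: fin_supp_block.
Qed.

Lemma eval_block y b n : (x - 1) * eval_word x (block y b n) =
  (x - 1) * y%:~R / x + b%:~R * (x ^+ n - 1).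
Proof.
elim: n => [|n IHn].
  rewrite subrr mulr0 addr0 -mulrA; congr (_ * _).
  have -> : block y b 0 = fun j => y * delta (-1) j.
    by apply: funext => j; rewrite /block /delta; do 2?case: ifP; lia.
  by rewrite eval_wordZ ?eval_word_delta ?exprN1//; exact: fin_supp_delta.
by rewrite eval_blockS mulrDr IHn exprS; ring.
Qed.

(** By shift invariance the image of the zero word is constant, and it has finite support. *)
Lemma local_zero : f (fun=> 0) 0 = 0.
Proof.
have [|_ [|[N fN] _]] := fP (u := fun=> 0); first by move=> j; lia.
  by exists 0%N.
by rewrite -[RHS](fN N.+1) ?absz_nat//; apply: fk.
Qed.

(* Lengthening a long block by one digit inserts one copy of c = Phi(b...b) in
   the output, which stays unchanged below position k and is shifted above;
   comparing values before and after isolates the low part of the output. *)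
Lemma block_low_part y b : 2 * m <= y <= 2 * M -> 2 * m <= b <= 2 * M ->
  exists w : int -> int,
  [/\ forall j, m <= w j <= M,
      forall j : int, (j < - k.+1%:Z) || ((k + k).+1%:Z - k.+1%:Z <= j) -> w j = 0 &
      (x - 1) * eval_word x w =
        (x - 1) * y%:~R / x - b%:~R + (f (fun=> b) 0)%:~R * x ^+ k].
Proof.
(* With [n = 2k], the window around position [k] covers exactly the [b] digits of the block of
   length [n + 1], so the output there is [c]. *)
move=> yM bM; set c := f _ _; pose n := (k + k)%N.
have uM i := block_bounds i yM bM.
have us i := fin_supp_block y b i.
have [vM /(_ (us n)) [vs vE]] := fP (uM n).
have [_ /(_ (us n.+1)) [_ v'E]] := fP (uM n.+1).
pose v := f (block y b n); rewrite -/v in vM vs vE.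
pose lo j : int := if j < k%:Z then v j else 0.
pose hi j : int := if j < k%:Z then 0 else v j.
have los : fin_supp lo by have [N vN] := vs; exists N => j /vN; rewrite /lo => ->; case: ifP.
have his : fin_supp hi by have [N vN] := vs; exists N => j /vN; rewrite /hi => ->; case: ifP.
have vD : v = lo \+ hi by apply: funext => j; rewrite /lo /hi /=; case: ifP; lia.
have v'D : f (block y b n.+1) = lo \+ ((fun j => c * delta k j) \+ (fun j => hi (j - 1))).
  apply: funext => j; rewrite /lo /hi /delta /=.
  case: (ltrgtP j k%:Z) => jk.
  - have -> : j - 1 < k%:Z by lia.
    rewrite mulr0 !addr0; apply: fk => i ik.
    by rewrite /block; case: ifP => // _; case: ifP; case: ifP; lia.
  - have -> : j - 1 < k%:Z = false by lia.
    rewrite mulr0 !add0r; apply: fk => i ik.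
    by rewrite /block; do 4?case: ifP; lia.
  - have -> : j - 1 < k%:Z by lia.
    rewrite mulr1 addr0 add0r; apply: fk => i ik.
    by rewrite /block; do 2?case: ifP; lia.
exists lo; split.
- by move=> j; have := vM j; rewrite /lo; case: ifP; lia.
- move=> j jk; rewrite /lo; case: ifP => // jk'.
  rewrite -local_zero; apply: fk => i ik.
  by rewrite /block; do 2?case: ifP; lia.
have ds := fin_suppZ c (fin_supp_delta k).
have hs := fin_supp_shift (-1) his.
move: vE; rewrite vD eval_wordD// => vE.
move: v'E; rewrite v'D eval_wordD//; last exact: fin_suppD.
rewrite eval_wordD// eval_wordZ; last exact: fin_supp_delta.
rewrite eval_word_delta eval_word_shift// expr1z eval_blockS -vE => v'E.
have := eval_block y b n; rewrite -vE mulrDr => E.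
(* Subtracting the two value equations leaves [c x^k + (x - 1) hi = b x^n], with [hi] standing for
   its value. *)
have {v'E} : (x - 1) * eval_word x hi = b%:~R * x ^+ n - c%:~R * x ^+ k.
  by move: v'E; rewrite -exprnP; lra.
by move: E; lra.
Qed.

Lemma eval_word_le (N n : nat) (B : int) w :
  (forall j : int, (j < - N%:Z) || (n%:Z - N%:Z <= j) -> w j = 0) ->
  (forall j, w j <= B) ->
  x ^+ N * ((x - 1) * eval_word x w) <= B%:~R * (x ^+ n - 1).
Proof.
move=> w0 wB; rewrite mulrCA (eval_word_poly _ w0)//.
rewrite subrX1 mulrCA ler_pM2l ?subr_gt0// mulr_sumr.
rewrite poly_def rmorph_sum horner_sum/=; apply: ler_sum => i _.
rewrite map_polyZ/= map_polyXn hornerZ hornerXn ler_pM2r ?ler_int//.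
by rewrite exprn_gt0// (lt_trans _ x1).
Qed.

(** For [y = 0], the identity of [block_low_part] times [x^(k+1)] says that [x] is a root of the
    integer polynomial [Q] below, and [Q] takes the value [b - c] at 1. *)
Lemma local_const_mod b : 2 * m <= b <= 2 * M ->
  exists z, f (fun=> b) 0 = b + (a%:Z - 2) * z.
Proof.
move=> bM; have [|w [_ w0]] := block_low_part (y := 0) _ bM; first by lia.
rewrite mulr0 mul0r sub0r; set c := f _ _ => wE.
set n := (k + k).+1 in w0; set N := k.+1 in w0.
pose P := \poly_(i < n) w (i%:Z - N%:Z).
pose Q := ('X - 1%:P) * P + b%:P * 'X^N - c%:P * 'X^n.
have [|z Q1] := @root_dvd_horner1 Q.
  rewrite /Q !(rmorphB, rmorphD, rmorphM)/= !map_polyXn map_polyX !map_polyC/=.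
  rewrite !hornerE -(eval_word_poly x0 w0) mulrCA wE.
  rewrite /n /N !exprS exprD; ring.
exists (- z); move: Q1; rewrite /Q !hornerE !expr1n; lia.
Qed.

Lemma card_int_conversion : 0 < M -> a%:Z <= M - m + 1.
Proof.
move=> M0; case: (lerP a%:Z (M - m + 1)) => // aM; exfalso.
have x2 := root_gt2.
have bM : 2 * m <= M <= 2 * M by lia.
have [z cE] := local_const_mod bM; set c := f _ _ in cE.
have cM : m <= c <= M by apply: (proj1 (fP (u := fun=> M) _)) => j; lia.
(* Here [M - m <= a - 2], so a nonzero multiple of [a - 2] leads from [M] to [m] or out of the
   alphabet. *)
have : c = M \/ c = m /\ M - m = a%:Z - 2.
  have [z0|[z0|z0]] : z = 0 \/ z <= -1 \/ 1 <= z by lia.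
  - by left; nia.
  - by right; nia.
  - by exfalso; nia.
have MR : 0 < M%:~R :> R by rewrite ltr0z.
have X : 0 < x ^+ k.+1 by rewrite exprn_gt0// (lt_trans _ x1).
have XE : x ^+ (k + k).+1 = x ^+ k.+1 * x ^+ k by rewrite -exprD addSn.
case=> [cM'|[cm _]].
  (* Now [(x - 1)] times the value of [w] is [M x^k + M (1 - 2/x)], which exceeds [M x^k] since
     [x > 2]; digits at most [M] keep it below [M x^k]. *)
  have [|w [wM w0]] := block_low_part (y := 2 * M) _ bM; first by lia.
  rewrite -/c cM' => wE.
  have := eval_word_le w0 (fun j => proj2 (andP (wM j))).
  rewrite wE XE intrM.
  have -> : (x - 1) * (2%:~R * M%:~R) / x = 2 * M%:~R * (1 - x^-1) by rewrite mulrAC; field.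
  have xV : x^-1 < 2^-1 by rewrite ltf_pV2 ?posrE; lra.
  have : 0 < x ^+ k.+1 * (M%:~R * (1 - 2 * x^-1)) by do !apply: mulr_gt0 => //; lra.
  move=> H; apply/negP; rewrite -ltNge; move: H MR.
  by move: (x ^+ k.+1) (x ^+ k) (x^-1) (M%:~R) => *; lra.
have [|w [wM w0]] := block_low_part (y := 0) _ bM; first by lia.
rewrite -/c cm mulr0 mul0r sub0r => wE.
have ws : fin_supp w by exists (k + k).+1 => j jk; apply: w0; lia.
(* Applied to [- w], the upper bound becomes a lower one: digits at least [m], with [m <= 0], keep
   [(x - 1)] times the value of [w] at or above [m x^k], yet it equals [m x^k - M]. *)
have := @eval_word_le k.+1 (k + k).+1 (- m) (fun j => - w j).
rewrite eval_wordN// mulrN wE XE intrN => H.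
have {}H : x ^+ k.+1 * - (- M%:~R + m%:~R * x ^+ k) <=
    - m%:~R * (x ^+ k.+1 * x ^+ k - 1).
  by apply: H => j; [move=> /w0 ->; rewrite oppr0|have := wM j; lia].
have mR : m%:~R <= 0 :> R by rewrite lerz0; lia.
have {}MR := mulr_gt0 X MR.
move: H; apply/negP; rewrite -ltNge; move: MR mR.
by move: (x ^+ k.+1) (x ^+ k) (M%:~R) (m%:~R) => *; lra.
Qed.

End Blocks.
End LowerBound.

Lemma int_conversion_opp (F : fieldType) (x : F) m M f :
  int_conversion x m M f -> int_conversion x (- M) (- m) (word_opp f).
Proof.
move=> fP u uM; have [|fM fx] := fP (fun i => - u i); first by move=> j; have := uM j; lia.
split=> [j|us]; first by rewrite /word_opp; have := fM j; lia.
have [vs vE] := fx (fin_suppN us).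
by split; [exact: fin_suppN|rewrite eval_wordN// vE eval_wordN// opprK].
Qed.

Theorem theorem35 (R : realType) (a : nat) (beta : R)
    (ha : (3 <= a)%N) (hbeta : 1 < beta)
    (hroot : beta ^+ 2 = a%:R * beta - 1) :
  (forall A : {fset R[i]},
     contiguous_integers A -> 0 \in A -> #|` A| = a ->
     allows_parallel_addition beta%:C%C A) /\
  (forall A : {fset R[i]},
     contiguous_integers A -> 0 \in A -> (exists2 x, x \in A & x != 0) ->
     (#|` A| < a)%N ->
     ~ allows_parallel_addition beta%:C%C A).
Proof.
have beta0 : beta != 0 by rewrite gt_eqF// (lt_trans ltr01).
split=> A [m [M [mM AE]]] A0.
  move=> Aa; have m0M : m <= 0 <= M by rewrite -(intr_alphabet 0 AE).
  apply/(allows_parallel_additionP beta AE m0M).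
  apply: exists_int_conversion hroot ha _ m0M => //.
  by rewrite -Aa (card_alphabet AE mM) addrK.
have m0M : m <= 0 <= M by rewrite -(intr_alphabet 0 AE).
move=> [y /AE[n nM ->]]; rewrite intr_eq0 => n0 Aa.
move=> /(allows_parallel_additionP beta AE m0M)[k [f [fk fP]]].
move: Aa; rewrite -ltz_nat (card_alphabet AE mM) ltNge => /negP; apply.
have [M0|M0] := ltrP 0 M; first exact: (card_int_conversion ha hbeta hroot fk fP m0M M0).
(* If [M = 0], the nonzero letter forces [m < 0], so the negated alphabet has a positive top
   digit. *)
have := card_int_conversion ha hbeta hroot (word_local_opp fk) (int_conversion_opp fP).
lia.
Qed.
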